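(* Let $L\subseteq\mathbb R^n$ be a convex body and $K\in\mathscr K(\mathbb R^n)$ such that $K\subseteq L$. Let $\mu=(\mu_j)_{j\ge1}$ be an admissible weight satisfying $\mu_j\ge j$ for $j\ge1$. Let $M_0>b_0>0$. Assume that $(\mu,M_0,a_K,b_0)$ is admissible and let $\mathbf N=\mathbf N(\mu,M_0,a_K,b_0)$. Let $f:L\to\mathbb R$ be a $(\mu^{|\mathbf N},M_0)$-smooth function satisfying $\|f\|_K\ge b_0$. Then for each Lebesgue measurable set $E\subseteq K$ with $|E|>0$, the mean oscillation of $\log|f|$ over $E$ satisfies $$\operatorname{mo}_E(\log|f|)\le 2\log\mathbf C_{\mathbf N}+2\mathbf N\Big(1+\log\Big(\frac{|K|}{\nu_K|E|}\Big)\Big).$$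
   Context: $|E|$ denotes Lebesgue measure. A convex body is a compact convex set with nonempty interior. The mean oscillation of an integrable $g$ over a measurable set $E$ with $0<|E|<\infty$ is $\operatorname{mo}_E(g):=\frac1{|E|}\int_E|g(x)-g_E|\,dx$ with $g_E:=\frac1{|E|}\int_E g(x)\,dx$. Weights and smoothness. An admissible weight is a sequence $\mu=(\mu_j)_{j\ge1}$ of reals with $0<\mu_1\le\mu_2\le\cdots$. Given $M_0>0$ put $M_j=M_0\mu_1\cdots\mu_j$, $j\ge1$. For $N\in\mathbb N_{\ge1}\cup\{\infty\}$ and nonempty compact $L\subseteq\mathbb R^n$, a map $f=(f_1,\dots,f_m):L\to\mathbb R^m$ is $(\mu^{|N},M_0)$-smooth if it is of class $C^N$ in some open neighborhood of $L$ and $\sup_{x\in L}\sum_{i=1}^m\sum_{|\alpha|=j}\frac{j!}{\alpha!}|\partial^\alpha f_i(x)|\le M_j$ for all integers $0\le j<N+1$. Also $\|f\|_E:=\sup_{x\in E}\sum_{i=1}^m|f_i(x)|$. Degree. For $A,a,b>0$ let $j_0$ be the smallest nonnegative integer $\ge\log(A/b)$. The tuple $(\mu,A,a,b)$ is admissible if $\sum_{j=j_0+1}^\infty 1/\mu_j>a\,e$; then $\mathbf N(\mu,A,a,b):=2\sup\{k\in\mathbb N:\sum_{j=j_0+1}^k\frac1{a\mu_j}<e\}$ (empty sums are $0$). The constant $\mathbf C_{\mathbf N}$. Fix an increasing continuous, (piecewise) $C^1$ function $\tilde\mu:[1,\infty)\to(0,\infty)$ with $\tilde\mu(j)=\mu_j$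 for integers $j\ge1$ (left derivatives are used at points of nondifferentiability), put $\gamma_{\tilde\mu}(k):=\sup_{1\le s\le k}\frac{s\tilde\mu'(s)}{\tilde\mu(s)}$, and $\mathbf C_{\mathbf N}:=(4e^{4+\gamma_{\tilde\mu}(\mathbf N)})^{\mathbf N}$. Admissible sets. A family $(K_w,a_w,\Upsilon_w)_{w\in W}$, where $W$ is any set, $K_w\subseteq[0,1]^n$ is compact, $a_w\in K_w$, and $\Upsilon_w:[0,\infty)^n\to\mathbb R^n$ is a map, is an admissible collection of degree $d\in\mathbb N_{\ge1}$ if there are constants $\delta_1,\delta_2,\delta_3>0$, $q\in\mathbb N_{\ge1}$ and polynomial maps $R_w:\mathbb R^n\to\mathbb R^n$ of degree at most $d$ such that for all $w\in W$: (1) $K_w$ is star-shaped with respect to $a_w$ and $|K_w|\ge\delta_1$; (2) $\Upsilon_w(x_1,\dots,x_n)=R_w(x_1^{1/q},\dots,x_n^{1/q})$; (3) $\delta_2\le\sum_\kappa|c_{w,\kappa}|\le\delta_3$, where $c_{w,\kappa}$ are the coefficients of the polynomial $\operatorname{Jac}(R_w)$ (the Jacobian determinant); (4) writing $a_w=(a_{w,1},\dots,a_{w,n})$, $a_{w,i}=0$ whenever $\Upsilon_w$ is not a polynomial map with respect to the variable $x_i$. A nonempty compact set $K\subseteq\mathbb R^n$ is admissible (of degree $d$) if there is an admissible collection (of degree $d$) $(K_w,a_w,\Upsilon_w)_{w\in K}$ indexed by $K$ with $\Upsilon_w(a_w)=w$ for each $w\in K$ and $K=\bigcup_{w\in K}\Upsilon_w(K_w)$.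 $\mathscr K(\mathbb R^n)$ is the family of all admissible sets. For each $K\in\mathscr K(\mathbb R^n)$ such a collection and its degree $d$ are fixed ($d=1$ if $K$ is a convex body), and $$a_K:=4\,\tfrac{(d+1)^{d+1}}{(d-1)^{d-1}}\max\{\operatorname{diam}(K),1\}\ \text{ if }d\ge2,\qquad a_K:=\operatorname{diam}(K)\ \text{ if }d=1.$$ The constant $\nu_K$. For $K\in\mathscr K(\mathbb R^n)$, $\nu_K\in(0,1]$ denotes a fixed constant depending only on $K$ (with $\nu_K=1/n$ if $K$ is a convex body) for which the paper's Remez inequality holds: for every convex body $L\supseteq K$, every admissible weight $\mu$ with $\mu_j\ge j$, all $M_0>b_0>0$ and $m\ge1$ with $(\mu,mM_0,a_K,b_0)$ admissible and $\mathbf N'=\mathbf N(\mu,mM_0,a_K,b_0)$, every $(\mu^{|\mathbf N'},M_0)$-smooth $f:L\to\mathbb R^m$ with $\|f\|_K\ge b_0$, and every measurable $E\subseteq K$ with $|E|>0$, $\|f\|_K\le\mathbf C_{\mathbf N'}\big(\frac{m|K|^{\nu_K}}{|K|^{\nu_K}-(|K|-|E|)^{\nu_K}}\big)^{\mathbf N'}\|f\|_E$. (Such a constant exists for every $K\in\mathscr K(\mathbb R^n)$.) *)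

(* Defs.v *)
From HB Require Import structures.
From mathcomp Require Import all_boot all_order all_algebra.
From mathcomp Require Import all_classical all_reals all_analysis.
From mathcomp Require mpoly.
(* The notations and names of mpoly clash with those of the analysis library. *)
Import (canonicals, coercions) mpoly.

Set Implicit Arguments.
Unset Strict Implicit.
Unset Printing Implicit Defensive.

Import Order.TTheory GRing.Theory Num.Theory.
Import numFieldNormedType.Exports.

Local Open Scope classical_set_scope.
Local Open Scope ring_scope.

Section LebesgueMeasure.
Context {R : realType} {n : nat}.

(* [None] is the empty box, so that finite covers are countable covers also
   in dimension 0. *)
Definition box (B : option ('rV[R]_n * 'rV[R]_n)) : set 'rV[R]_n :=
  if B is Some (a, b) then [set x | forall i, a 0 i < x 0 i <= b 0 i] else set0.

Definition box_volume (B : option ('rV[R]_n * 'rV[R]_n)) : R :=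
  if B is Some (a, b) then \prod_(i < n) Num.max 0 (b 0 i - a 0 i) else 0.

Definition box_cover (A : set 'rV[R]_n) :
    set (nat -> option ('rV[R]_n * 'rV[R]_n)) :=
  [set B | A `<=` \bigcup_k box (B k)].

Definition lebesgue_outer (A : set 'rV[R]_n) : \bar R :=
  ereal_inf [set (\sum_(k <oo) (box_volume (B k))%:E)%E | B in box_cover A].

Local Open Scope ereal_scope.

Lemma box_volume_ge0 B : 0 <= (box_volume B)%:E.
Proof.
case: B => [[a b]|]; rewrite lee_fin //=.
by apply: prodr_ge0 => i _; rewrite le_max lexx.
Qed.

Let lebesgue_outer_ge0 A : 0 <= lebesgue_outer A.
Proof.
apply: le_ereal_inf_tmp => _ [B _ <-].
by apply: nneseries_ge0 => k _ _; exact: box_volume_ge0.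
Qed.

Let lebesgue_outer0 : lebesgue_outer set0 = 0.
Proof.
apply/eqP; rewrite eq_le lebesgue_outer_ge0 andbT.
apply: ereal_inf_lbound; exists (fun=> None) => //.
by rewrite eseries0.
Qed.

Let le_lebesgue_outer : {homo lebesgue_outer : A B / A `<=` B >-> A <= B}.
Proof.
move=> A B AB; apply/ereal_inf_le_tmp => x [C BC <-{x}].
by exists C => //; exact: subset_trans BC.
Qed.

Let lebesgue_outer_sigma_subadditive : sigma_subadditive lebesgue_outer.
Proof.
move=> A; have [[i ioo]|] := pselect (exists i, lebesgue_outer (A i) = +oo).
  rewrite (eseries_pinfty _ _ ioo) ?leey// => k _.
  by rewrite -ltNye (lt_le_trans _ (lebesgue_outer_ge0 _)).
rewrite -forallNE => Aoo.
suff add2e (e : {posnum R}) :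
    lebesgue_outer (\bigcup_n A n) <=
    \sum_(i <oo) lebesgue_outer (A i) + e%:num%:E.
  by apply/lee_addgt0Pr => _/posnumP[].
rewrite (le_trans _ (epsilon_trick _ _ _))//.
pose vol B := (box_volume B)%:E.
pose P k B := box_cover (A k) B /\
  \sum_(j <oo) vol (B j) <= lebesgue_outer (A k) + (e%:num / (2 ^ k.+1)%:R)%:E.
have [G PG] : {G : nat -> nat -> option ('rV[R]_n * 'rV[R]_n) &
    forall k, P k (G k)}.
  apply: (@choice _ _ P) => k; rewrite /P /lebesgue_outer.
  set S := (X in ereal_inf X); move infS : (ereal_inf S) => iS.
  case: iS infS => [r Sr|Soo|Soo].
  - have en1 : (0 < e%:num / (2 ^ k.+1)%:R)%R by [].
    have /(lb_ereal_inf_adherent en1) : ereal_inf S \is a fin_num by rewrite Sr.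
    move=> [x [B AnB muBx] xS].
    by exists B; split => //; rewrite muBx -Sr; exact/ltW.
  - by have := Aoo k; rewrite /lebesgue_outer Soo.
  - by have := lebesgue_outer_ge0 (A k); rewrite /lebesgue_outer Soo.
have volG_ge0 x : 0 <= (vol \o uncurry G) x by exact: box_volume_ge0.
apply: (@le_trans _ _ (\esum_(i in setT) (vol \o uncurry G) i)).
  apply: ereal_inf_lbound => /=.
  have /card_esym/ppcard_eqP[f] := card_nat2.
  exists (uncurry G \o f).
    move=> t [i _ /(PG i).1 [j _ Bijt]].
    by exists (f^-1%FUN (i, j)) => //=; rewrite invK ?inE.
  rewrite -(esum_pred_image (vol \o uncurry G) _ xpredT) ?[fun=> _]set_true//.
  by rewrite image_eq.
rewrite (_ : esum _ _ = \sum_(i <oo) \sum_(j <oo ) vol (G i j)); last first.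
  pose J : nat -> set (nat * nat) := fun i => [set (i, j) | j in setT].
  rewrite (_ : setT = \bigcup_k J k); last first.
    by rewrite predeqE => -[a b]; split => // _; exists a => //; exists b.
  rewrite esum_bigcupT /=; last 2 first.
    - apply/trivIsetP => i j _ _ ij.
      rewrite predeqE => -[k m] /=; split => //= -[] [_] _ [<-{k} _].
      by move=> [m' _] [] /esym/eqP; rewrite (negbTE ij).
    - by move=> k; exact: volG_ge0.
  rewrite -(image_id [set: nat]) -fun_true esum_pred_image//; last first.
    by move=> k _; apply: esum_ge0 => z _; exact: volG_ge0.
  apply: eq_eseriesr => /= j _.
  rewrite -(esum_pred_image (vol \o uncurry G) (pair j) predT)//=; last first.
    by move=> ? ? _ _; exact: (@can_inj _ _ _ snd).
    by move=> k _; exact: box_volume_ge0.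
  by congr esum; rewrite predeqE => -[a b]; split; move=> [i _ <-]; exists i.
apply: lee_lim.
- apply: is_cvg_nneseries => k *.
  by apply: nneseries_ge0 => m *; exact: (volG_ge0 (k, m)).
- by apply: is_cvg_nneseries => k *; apply: adde_ge0 => //; exact: lebesgue_outer_ge0.
- by near=> k; apply: lee_sum => i _; exact: (PG i).2.
Unshelve. all: by end_near. Qed.

HB.instance Definition _ := isOuterMeasure.Build R 'rV[R]_n lebesgue_outer
  lebesgue_outer0 lebesgue_outer_ge0 le_lebesgue_outer
  lebesgue_outer_sigma_subadditive.

End LebesgueMeasure.

(* As a plain type [euclid R n] is ['rV[R]_n]; its measurable sets are the
   Lebesgue (Caratheodory) measurable ones. *)
Definition euclid (R : realType) (n : nat) :=
  caratheodory_type (@lebesgue_outer R n).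

HB.instance Definition _ (R : realType) (n : nat) :=
  Measurable.on (euclid R n).

Definition lebesgue (R : realType) (n : nat) : set (euclid R n) -> \bar R :=
  lebesgue_outer.

HB.instance Definition _ (R : realType) (n : nat) :=
  isMeasure.Build _ (euclid R n) R (@lebesgue R n)
    (@caratheodory_measure0 R _ lebesgue_outer)
    (@caratheodory_measure_ge0 R _ lebesgue_outer)
    (@caratheodory_measure_sigma_additive R _ lebesgue_outer).

Arguments lebesgue {R n}.

Definition lebesgue_measurable (R : realType) (n : nat) (E : set 'rV[R]_n) :=
  measurable (E : set (euclid R n)).

(* Real-valued; only meaningful for sets of finite measure. *)
Definition vol (R : realType) (n : nat) (E : set 'rV[R]_n) : R :=
  fine (lebesgue E).

(* The functions below are extended-real valued because log|f| is -oo at the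
   zeros of f. *)
Definition mean (R : realType) (n : nat) (E : set 'rV[R]_n)
    (g : 'rV[R]_n -> \bar R) : \bar R :=
  ((vol E)^-1%:E * \int[lebesgue]_(x in E) g x)%E.

Definition mean_oscillation (R : realType) (n : nat) (E : set 'rV[R]_n)
    (g : 'rV[R]_n -> \bar R) : \bar R :=
  ((vol E)^-1%:E * \int[lebesgue]_(x in E) `|g x - mean E g|)%E.

Definition log_abs (R : realType) (n : nat) (f : 'rV[R]_n -> R)
    (x : 'rV[R]_n) : \bar R := lne `|f x|%:E.

Section Geometry.
Context {R : realType} {n : nat}.
Implicit Types K : set 'rV[R]_n.

Definition convex_body K := [/\ compact K, convex_set K & K° !=set0].

(* The norm of the library on ['rV[R]_n] is the sup norm. *)
Definition euclidean_dist (x y : 'rV[R]_n) : R :=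
  Num.sqrt (\sum_(i < n) (x 0 i - y 0 i) ^+ 2).

Definition diam K : R :=
  sup [set euclidean_dist p.1 p.2 | p in K `*` K].

Definition star_shaped K (a : 'rV[R]_n) :=
  forall x (t : R), K x -> 0 <= t <= 1 -> K (a + t *: (x - a)).

Definition unit_cube : set 'rV[R]_n := [set x | forall i, 0 <= x 0 i <= 1].

Definition orthant : set 'rV[R]_n := [set x | forall i, 0 <= x 0 i].

End Geometry.

(* A weight is a function on [nat] whose value at 0 is irrelevant. *)
Definition admissible_weight (R : realType) (mu : nat -> R) :=
  0 < mu 1%N /\ forall j, (1 <= j)%N -> mu j <= mu j.+1.

Section Smoothness.
Context {R : realType} {n : nat}.

Definition iter_partial (s : seq 'I_n) (g : 'rV[R]_n -> R) : 'rV[R]_n -> R :=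
  foldr (fun i h => 'D_(delta_mx 0 i) h) g s.

Definition partial (alpha : 'I_n -> nat) (g : 'rV[R]_n -> R) : 'rV[R]_n -> R :=
  iter_partial (flatten [seq nseq (alpha i) i | i <- enum 'I_n]) g.

Definition class_C (N : nat) (U : set 'rV[R]_n) (g : 'rV[R]_n -> R) :=
  (forall (s : seq 'I_n) i x, (size s < N)%N -> U x ->
     derivable (iter_partial s g) x (delta_mx 0 i)) /\
  (forall (s : seq 'I_n) x, (size s <= N)%N -> U x ->
     {for x, continuous (iter_partial s g)}).

(* The components of a multi-index of length j are at most j. *)
Definition jet_norm (m : nat) (f : 'I_m -> 'rV[R]_n -> R) (j : nat)
    (x : 'rV[R]_n) : R :=
  \sum_(i < m)
    \sum_(alpha : {ffun 'I_n -> 'I_j.+1} | (\sum_(k < n) alpha k == j)%N)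
      (j`!%:R / (\prod_(k < n) (alpha k)`!)%N%:R)
        * `|partial (fun k => alpha k) (f i) x|.

Definition weight_prod (mu : nat -> R) (M0 : R) (j : nat) : R :=
  M0 * \prod_(1 <= i < j.+1) mu i.

(* A map L -> R^m is given by its components, extended arbitrarily outside a
   neighborhood of L. *)
Definition smooth (mu : nat -> R) (N : nat) (M0 : R) (L : set 'rV[R]_n)
    (m : nat) (f : 'I_m -> 'rV[R]_n -> R) :=
  (exists U : set 'rV[R]_n,
     [/\ open U, L `<=` U & forall i, class_C N U (f i)]) /\
  (forall j, (j <= N)%N -> forall x, L x ->
     jet_norm f j x <= weight_prod mu M0 j).

Definition sup_norm (E : set 'rV[R]_n) (m : nat) (f : 'I_m -> 'rV[R]_n -> R)
    : R :=
  sup [set \sum_(i < m) `|f i x| | x in E].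

End Smoothness.

Section Degree.
Context {R : realType}.

Definition start_index (A b : R) : nat :=
  absz (Num.max 0 (Num.ceil (ln (A / b)))).

Definition admissible_tuple (mu : nat -> R) (A a b : R) :=
  [/\ 0 < A, 0 < a, 0 < b &
    ((a * expR 1)%:E < \sum_((start_index A b).+1 <= j <oo) ((mu j)^-1)%:E)%E].

Definition degree (mu : nat -> R) (A a b : R) : nat :=
  (2 * supremum 0 [set k : nat |
    (\sum_((start_index A b).+1 <= j < k.+1) (a * mu j)^-1 < expR 1)%R])%N.

End Degree.

Section ConstantCN.
Context {R : realType}.

(* h is C^1 on each of the closed intervals cut out by a locally finite
   subdivision of [1, +oo[. *)
Definition piecewise_C1 (h : R -> R) :=
  exists t : nat -> R,
    [/\ t 0%N = 1, forall i, t i < t i.+1, t i @[i --> \oo] --> +oo &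
      forall i, exists g : R -> R,
        {within `[t i, t i.+1], continuous g} /\
        forall x, x \in `]t i, t i.+1[ -> is_derive x 1 h (g x)].

Definition interpolant (mu : nat -> R) (h : R -> R) :=
  [/\ {in `[1, +oo[ &, {homo h : x y / x <= y}},
      {within `[1, +oo[, continuous h},
      piecewise_C1 h,
      forall x, 1 <= x -> 0 < h x &
      forall j, (1 <= j)%N -> h j%:R = mu j].

(* The left derivative agrees with the derivative where the latter exists; at
   the left endpoint 1 of the domain the derivative is one-sided. *)
Definition onesided_derive (h : R -> R) (s : R) : R :=
  if 1 < s then lim ((h (s + t) - h s) / t @[t --> 0^'-])
  else lim ((h (s + t) - h s) / t @[t --> 0^'+]).

Definition gamma (h : R -> R) (k : R) : R :=
  sup [set s * onesided_derive h s / h s | s in `[1, k]].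

Definition constC (h : R -> R) (N : nat) : R :=
  (4 * expR (4 + gamma h N%:R)) ^+ N.

End ConstantCN.

Section AdmissibleSets.
Context {R : realType} {n : nat}.
Local Notation poly_map := ('I_n -> mpoly.mpoly n R).

Definition poly_eval (P : poly_map) (x : 'rV[R]_n) : 'rV[R]_n :=
  \row_i mpoly.meval (fun j => x 0 j) (P i).

(* [mpoly.msize] is one more than the total degree. *)
Definition poly_map_deg_le (d : nat) (P : poly_map) :=
  forall i, (mpoly.msize (P i) <= d.+1)%N.

Definition poly_jac (P : poly_map) : mpoly.mpoly n R :=
  \det (\matrix_(i < n, j < n) mpoly.mderiv j (P i)).

Definition coef_sum (p : mpoly.mpoly n R) : R :=
  \sum_(k <- mpoly.msupp p) `|mpoly.mcoeff k p|.

Definition root_row (q : nat) (x : 'rV[R]_n) : 'rV[R]_n :=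
  \row_j (x 0 j `^ q%:R^-1).

Definition polynomial_in (i : 'I_n) (Y : 'rV[R]_n -> 'rV[R]_n) :=
  forall x, orthant x -> forall k, exists p : {poly R}, forall t : R, 0 <= t ->
    Y (\row_j if j == i then t else x 0 j) 0 k = p.[t].

(* Families indexed by W are functions on an ambient type I of which only the
   values on W matter; the maps Y w are only considered on the orthant. *)
Definition admissible_collection (d : nat) (I : Type) (W : set I)
    (Kw : I -> set 'rV[R]_n) (a : I -> 'rV[R]_n)
    (Y : I -> 'rV[R]_n -> 'rV[R]_n) :=
  [/\ (1 <= d)%N,
    forall w, W w -> [/\ compact (Kw w), Kw w `<=` unit_cube & Kw w (a w)] &
    exists (delta1 delta2 delta3 : R) (q : nat) (P : I -> poly_map),
      [/\ 0 < delta1, 0 < delta2, 0 < delta3, (1 <= q)%N &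
        forall w, W w ->
        [/\ poly_map_deg_le d (P w),
          star_shaped (Kw w) (a w) /\ (delta1%:E <= lebesgue (Kw w))%E,
          forall x, orthant x -> Y w x = poly_eval (P w) (root_row q x),
          delta2 <= coef_sum (poly_jac (P w)) <= delta3 &
          forall i, ~ polynomial_in i (Y w) -> a w 0 i = 0]]].

Definition admissible_set (d : nat) (K : set 'rV[R]_n) :=
  [/\ K !=set0, compact K &
    exists (Kw : 'rV[R]_n -> set 'rV[R]_n) (a : 'rV[R]_n -> 'rV[R]_n)
      (Y : 'rV[R]_n -> 'rV[R]_n -> 'rV[R]_n),
      [/\ admissible_collection d K Kw a Y,
        forall w, K w -> Y w (a w) = w &
        K = \bigcup_(w in K) (Y w @` Kw w)]].

Definition constA (d : nat) (K : set 'rV[R]_n) : R :=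
  if (2 <= d)%N then
    4 * ((d.+1 ^ d.+1)%:R / (d.-1 ^ d.-1)%:R) * Num.max (diam K) 1
  else diam K.

(* [mut mu] is the interpolant chosen for the weight mu. *)
Definition remez_inequality (mut : (nat -> R) -> R -> R) (d : nat)
    (K : set 'rV[R]_n) (nu : R) :=
  forall (L : set 'rV[R]_n) (mu : nat -> R) (M0 b0 : R) (m : nat),
    convex_body L -> K `<=` L ->
    admissible_weight mu -> (forall j, (1 <= j)%N -> j%:R <= mu j) ->
    0 < b0 -> b0 < M0 -> (1 <= m)%N ->
    admissible_tuple mu (m%:R * M0) (constA d K) b0 ->
    let N := degree mu (m%:R * M0) (constA d K) b0 in
    forall f : 'I_m -> 'rV[R]_n -> R,
    smooth mu N M0 L f -> b0 <= sup_norm K f ->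
    forall E : set 'rV[R]_n, lebesgue_measurable E -> E `<=` K ->
    (0 < lebesgue E)%E ->
    sup_norm K f <=
      constC (mut mu) N *
      (m%:R * vol K `^ nu / (vol K `^ nu - (vol K - vol E) `^ nu)) ^+ N *
      sup_norm E f.

Definition remez_exponent (mut : (nat -> R) -> R -> R) (d : nat)
    (K : set 'rV[R]_n) (nu : R) :=
  [/\ 0 < nu <= 1, convex_body K -> nu = n%:R^-1 &
    remez_inequality mut d K nu].

End AdmissibleSets.

(* Main.v *)
(** With [S := sup_K |f|], set [h := ln S - log|f|], which is nonnegative on [E].
  Applied to the sublevel set [F = E `&` [set x | t <= h x]], where
  [|f| <= S * expR (- t)], the Remez inequality gives
  [expR t <= C * (|K| / (nu * |F|)) ^+ N], because
  [a `^ nu - (a - w) `^ nu >= nu * a `^ nu * w / a] for [nu <= 1].  So the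
  distribution function of [h] decays exponentially from the level
  [s := ln C + N * ln (|K| / (nu * |E|))] on, and the integral of [h] over [E]
  is at most [(s + N) * |E|].  The mean oscillation of [log|f|] is at most twice
  its mean distance to the constant [ln S], that is, twice the mean of [h].

  The integral of [h] is estimated by cutting the range of [h] above [s] into
  steps of length [r] and letting [r] tend to 0. *)
Require Import Defs.
From HB Require Import structures.
From mathcomp Require Import all_boot all_order all_algebra.
From mathcomp Require Import all_classical all_reals all_analysis.
From mathcomp Require Import measurable_realfun lra ring.
Import Order.TTheory GRing.Theory Num.Theory.
Import numFieldNormedType.Exports.
Local Open Scope classical_set_scope.
Local Open Scope ring_scope.

(** * Lebesgue measurability of open sets and finite measure of compact sets *)

Section LebesgueRV.
Context {R : realType} {n : nat}.
Implicit Types (A : set 'rV[R]_n) (B : option ('rV[R]_n * 'rV[R]_n)).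

(** If the hyperplane misses the box, one of the two pieces has inverted sides, and [box_volume]
    counts it as 0. *)
Let cut_low (i : 'I_n) (c : R) B :=
  if B is Some (a, b)
  then Some (\row_j (if j == i then Num.max (a 0 i) c else a 0 j), b) else None.

Let cut_high (i : 'I_n) (c : R) B :=
  if B is Some (a, b)
  then Some (a, \row_j (if j == i then Num.min (b 0 i) c else b 0 j)) else None.

Let box_cut_low i c B : box B `&` [set x | c < x 0 i] `<=` box (cut_low i c B).
Proof.
case: B => [[a b]|] x [] //= Bx cx j; rewrite mxE.
case: eqP => [->|_]; last exact: Bx.
by rewrite gt_max cx; have := Bx i; case/andP => -> ->.
Qed.

Let box_cut_high i c B :
  box B `&` [set x | x 0 i <= c] `<=` box (cut_high i c B).
Proof.
case: B => [[a b]|] x [] //= Bx cx j; rewrite mxE.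
case: eqP => [->|_]; last exact: Bx.
by rewrite le_min cx; have := Bx i; case/andP => -> ->.
Qed.

Let box_volume_cut i c B :
  box_volume B = box_volume (cut_low i c B) + box_volume (cut_high i c B).
Proof.
case: B => [[a b]|] /=; last by rewrite addr0.
rewrite !(bigD1 (P := xpredT) i)//= !mxE eqxx.
rewrite [X in _ = _ * X + _](eq_bigr (fun j => Num.max 0 (b 0 j - a 0 j)));
  last first.
  by move=> j /negPf ji; rewrite !mxE ji.
rewrite [X in _ = _ + _ * X](eq_bigr (fun j => Num.max 0 (b 0 j - a 0 j)));
  last first.
  by move=> j /negPf ji; rewrite !mxE ji.
rewrite -mulrDl; congr (_ * _).
rewrite /Num.max /Num.min.
by do ?case: ifPn; rewrite -?leNgt => *; lra.
Qed.

(** Caratheodory's criterion: the hyperplane cuts each box of a cover into two boxes whose volumes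
    add up, which gives covers of both parts at the same total cost. *)
Lemma half_space_lebesgue_measurable (i : 'I_n) (c : R) :
  lebesgue_measurable [set x : 'rV[R]_n | c < x 0 i].
Proof.
apply: le_caratheodory_measurable => X.
rewrite [leRHS]/(lebesgue_outer X).
apply: le_ereal_inf_tmp => _ [B XB <-].
rewrite (eq_eseriesr (g := fun k => (box_volume (cut_low i c (B k)))%:E
  + (box_volume (cut_high i c (B k)))%:E)%E); last first.
  by move=> k _; rewrite -EFinD -box_volume_cut.
rewrite nneseriesD; [|by move=> *; exact: box_volume_ge0..].
apply: leeD; apply: ereal_inf_lbound => /=.
  exists (cut_low i c \o B) => //= x [/XB[k _ Bkx] cx].
  by exists k => //; exact: box_cut_low.
exists (cut_high i c \o B) => //= x [/XB[k _ Bkx] /negP]; rewrite -leNgt => cx.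
by exists k => //; exact: box_cut_high.
Qed.

Lemma box_lebesgue_measurable B : lebesgue_measurable (box B).
Proof.
case: B => [[a b]|]; last exact: measurable0.
rewrite (_ : box _ = \bigcap_(i in [set: 'I_n])
    ([set x | a 0 i < x 0 i] `\` [set x | b 0 i < x 0 i])).
  apply: fin_bigcap_measurable => // i _.
  by apply: measurableD; exact: half_space_lebesgue_measurable.
apply/seteqP; split => x /= H i; last first.
  by have /= [ax /negP] := H i Logic.I; rewrite -leNgt ax.
by move=> _; have /andP[ax xb] := H i; split => //=; apply/negP; rewrite -leNgt.
Qed.

Lemma open_lebesgue_measurable A : open A -> lebesgue_measurable A.
Proof.
move=> oA.
(* Boxes with rational corners are countably many; those not contained in [A] are replaced by
   [set0]. *)
pose F (p : 'rV[rat]_n * 'rV[rat]_n) :=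
  let B := box (Some (map_mx (@ratr R) p.1, map_mx (@ratr R) p.2)) in
  if `[< B `<=` A >] then B else set0.
rewrite (_ : A = \bigcup_p F p).
  apply: (@countable_bigcupT_measurable _ (euclid R n)) => [|p].
    exact: countableP.
  rewrite /F; case: ifP => _; first exact: box_lebesgue_measurable.
  exact: measurable0.
apply/seteqP; split => [x Ax|x [p _]]; last first.
  by rewrite /F; case: asboolP => // + ; apply.
have /nbhs_ballP[e /= e0 eA] : nbhs x A by exact: open_nbhs_nbhs.
have [a ha] : {a : 'I_n -> rat & forall i, ratr (a i) \in `]x 0 i - e, x 0 i[}.
  apply: (@choice _ _ (fun i q => ratr q \in `]x 0 i - e, x 0 i[)) => i.
  by apply: rat_in_itvoo; lra.
have [b hb] : {b : 'I_n -> rat & forall i, ratr (b i) \in `]x 0 i, x 0 i + e[}.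
  apply: (@choice _ _ (fun i q => ratr q \in `]x 0 i, x 0 i + e[)) => i.
  by apply: rat_in_itvoo; lra.
exists (\row_i a i, \row_i b i) => //.
rewrite /F; case: asboolP => [_ i|].
  by rewrite !mxE; move: (ha i) (hb i); rewrite !in_itv/=; lra.
case => y /= By; apply: eA; split => // i j; rewrite ord1.
have := By j; rewrite !mxE => /andP[y1 y2].
by rewrite /ball/= ltr_distlC; move: (ha j) (hb j); rewrite !in_itv/=; lra.
Qed.

Lemma compact_lebesgue_lty A : compact A -> (lebesgue A < +oo)%E.
Proof.
move=> /compact_bounded[M [_ /(_ (M + 1))]].
rewrite ltrDl ltr01 => /(_ isT) AM.
(* Boxes are open on the left, so the bound [M + 1] has to be enlarged strictly; [M] may be
   negative. *)
pose c : R := `|M| + 2.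
pose B := Some (const_mx (- c), const_mx c) : option ('rV[R]_n * 'rV[R]_n).
pose Bk (k : nat) := if (k == 0)%N then B else None.
apply: (@le_lt_trans _ _ (\sum_(k <oo) (box_volume (Bk k))%:E)%E).
  apply: ereal_inf_lbound; exists Bk => //.
  move=> x /AM; rewrite /= => xM; exists 0%N => //= i; rewrite !mxE.
  have : `|x 0 i| <= `|x|.
    rewrite (_ : `|x| = mx_norm x)// mx_normrE.
    exact: (le_bigmax _ (fun ij => `|x ij.1 ij.2|) (0, i)).
  move=> /le_trans/(_ xM); rewrite ler_norml; have := ler_norm M; rewrite /c; lra.
rewrite (nneseries_split 0 1); last by move=> *; exact: box_volume_ge0.
rewrite big_nat1.
by rewrite eseries0 ?adde0 ?ltry// => -[].
Qed.

End LebesgueRV.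

(** * Mean oscillation and distance to a constant *)

(** The mean of [g] differs from [c] by at most the mean of [|c - g|], so the triangle inequality
    through [c] costs a factor 2. *)
Lemma integral_sub_mean_le d (T : measurableType d) (R : realType)
    (mu : {measure set T -> \bar R}) (E : set T) (g : T -> \bar R) (v c : R) :
  measurable E -> mu E = v%:E -> 0 < v -> mu.-integrable E g ->
  (\int[mu]_(x in E) `|g x - v^-1%:E * \int[mu]_(x in E) g x| <=
   2%:E * \int[mu]_(x in E) `|c%:E - g x|)%E.
Proof.
move=> mE Ev v0 ig.
have mcst (k : R) : mu.-integrable E (cst k%:E).
  apply/integrableP; split; first exact: measurable_cst.
  by rewrite integral_cst//= Ev -EFinM ltry.
have Icst (k : R) : (\int[mu]_(x in E) k%:E = (k * v)%:E)%E.
  by rewrite EFinM -Ev -(integral_cst mu mE).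
have icg : mu.-integrable E (fun x => c%:E - g x)%E.
  exact: (integrableB mE (mcst c) ig).
have mg := measurable_int _ ig.
set I := (\int[mu]_(x in E) `|c%:E - _|)%E.
set J := (\int[mu]_(x in E) g x)%E.
have [i Ii] : exists i, I = i%:E.
  exists (fine I); rewrite fineK//; apply: integrable_fin_num => //.
  exact: integrable_abse.
have [j Jj] : exists j, J = j%:E.
  by exists (fine J); rewrite fineK//; exact: integrable_fin_num.
rewrite Jj -EFinM; set m := _ * j.
have cmI : `|c - m| * v <= i.
  rewrite -[X in `|_| * X]gtr0_norm// -normrM.
  rewrite (_ : (c - m) * v = c * v - j); last first.
    by rewrite /m; field; rewrite gt_eqF.
  have := le_abse_integral mu mE (measurable_int _ icg).
  by rewrite -/I Ii (integralB mE (mcst c) ig) /= Icst -/J Jj lee_fin.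
apply: (@le_trans _ _ (I + (`|c - m| * v)%:E)%E); last first.
  by rewrite Ii -EFinD -EFinM lee_fin; lra.
rewrite -Icst -(integralD mE (integrable_abse icg) (mcst `|c - m|)).
apply: ge0_le_integral => //.
- by apply: measurableT_comp => //; exact: emeasurable_funB.
- apply: emeasurable_funD; last exact: measurable_cst.
  by apply: measurableT_comp => //; exact: measurable_int icg.
- move=> x _; rewrite -abseN.
  rewrite (_ : - (g x - _) = (c%:E - g x) - (c - m)%:E)%E.
    exact: lee_abs_sub.
  (* The regrouping must also hold where [g] is infinite. *)
  by case: (g x) => [y| |] //=; rewrite -?EFinN -?EFinD; congr (_%:E); ring.
Qed.

Section MeanOscillation.
Context {R : realType} {n : nat}.
Implicit Types (D U E : set 'rV[R]_n) (f : 'rV[R]_n -> R).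

(** The condition [c < log|f|] means [expR c < |f|], also at the zeros of [f], and is open within
    [U], where [f] is continuous. *)
Lemma measurable_log_abs D U f : open U -> D `<=` U ->
  (forall x, U x -> {for x, continuous f}) -> lebesgue_measurable D ->
  measurable_fun (D : set (euclid R n)) (log_abs f).
Proof.
move=> oU DU cf mD _.
apply: (measurability _ (ErealGenOInfty.measurableE R)) => // _ [_ [c ->] <-].
rewrite (_ : _ `&` _ = D `&` (U `&` [set x | expR c < `|f x|])).
  apply: measurableI => //; apply: open_lebesgue_measurable.
  rewrite openE => x [Ux cx]; apply: filterI; first exact: open_nbhs_nbhs.
  have fx := cvg_norm (cf x Ux : f y @[y --> x] --> f x).
  exact: (cvgr_gt _ (fx _) _ cx).
have E x : (c%:E < log_abs f x)%E = (expR c < `|f x|).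
  rewrite /log_abs; have [->|f0] := eqVneq (f x) 0.
    by rewrite normr0 le0_lneNy// ltNge leNye ltNge ltW// expR_gt0.
  rewrite lne_EFin ?normr_gt0// lte_fin.
  by rewrite -[in RHS](@lnK _ `|f x|) ?posrE ?normr_gt0// ltr_expR.
apply/seteqP; split => x /=; rewrite in_itv/= andbT E.
  by case=> Dx ->; do !split => //; exact: DU.
by case=> Dx [_ ->].
Qed.

Lemma mean_oscillation_le E (g : 'rV[R]_n -> \bar R) (c : R) :
  lebesgue_measurable E -> (0 < lebesgue E < +oo)%E ->
  lebesgue.-integrable E g ->
  (mean_oscillation E g <=
   2%:E * ((vol E)^-1%:E * \int[lebesgue]_(x in E) `|c%:E - g x|))%E.
Proof.
move=> mE /andP[E0 Eoo] ig.
have Ev : lebesgue E = (vol E)%:E by rewrite fineK// ge0_fin_numE.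
have v0 : 0 < vol E by rewrite -lte_fin -Ev.
rewrite muleCA lee_pmul2l ?lte_fin ?invr_gt0//.
exact: (integral_sub_mean_le _ (euclid R n)).
Qed.

End MeanOscillation.

(** * Elementary bounds for the Remez factor *)

(* The convexity inequality [expR (nu * u) <= nu * expR u + (1 - nu)] at
  [u = ln x], obtained from the tangents to [expR] at [0]. *)
Lemma powR_le_tangent {R : realType} (x nu : R) :
  0 < nu <= 1 -> 0 <= x -> x `^ nu <= 1 + nu * (x - 1).
Proof.
move=> /andP[nu0 nu1]; rewrite le_eqVlt => /predU1P[<-|x0].
  rewrite powR0 ?gt_eqF//. lra.
rewrite /powR gt_eqF//; set u := ln x.
have xE : x = expR u by rewrite lnK.
have h1 := expR_ge1Dx (u - nu * u).
have h2 := expR_ge1Dx (- (nu * u)).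
have {}h1 : expR (nu * u) * (1 + (u - nu * u)) <= x.
  by rewrite [leRHS]xE -[in leRHS](subrKC (nu * u) u) expRD ler_pM2l ?expR_gt0.
have {}h2 : expR (nu * u) * (1 - nu * u) <= 1.
  by rewrite -[leRHS](expRxMexpNx_1 (nu * u)) ler_pM2l ?expR_gt0.
(* With the weights [nu] and [1 - nu] the terms linear in [u] on the left cancel. *)
have := lerD (ler_wpM2l (ltW nu0) h1) (ler_wpM2l (_ : 0 <= 1 - nu) h2).
rewrite subr_ge0 => /(_ nu1); set e := expR _; nra.
Qed.

(** The tangent bound at [1 - w / a] bounds the denominator below by a multiple of [w], so that the
    Remez factor is replaced by a multiple of [1 / w]. *)
Lemma powR_ratio_le {R : realType} (a w nu : R) :
  0 < nu <= 1 -> 0 < w <= a ->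
  0 <= a `^ nu / (a `^ nu - (a - w) `^ nu) <= a / nu / w.
Proof.
move=> /[dup] nu01 /andP[nu0 _] /andP[w0 wa].
have a0 : 0 < a by exact: lt_le_trans wa.
have p0 : 0 < a `^ nu by exact: powR_gt0.
have x0 : 0 <= 1 - w / a by rewrite subr_ge0 ler_pdivrMr// mul1r.
have tangent : a `^ nu * (nu * w / a) <= a `^ nu - (a - w) `^ nu.
  rewrite (_ : a - w = a * (1 - w / a)); last by field; rewrite gt_eqF.
  rewrite powRM//; last exact: ltW.
  rewrite -[X in X - _]mulr1 -mulrBr ler_pM2l//.
  by have := powR_le_tangent _ _ nu01 x0; lra.
have den0 : 0 < a `^ nu - (a - w) `^ nu.
  by apply: lt_le_trans tangent; rewrite mulr_gt0// divr_gt0// mulr_gt0.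
apply/andP; split; first by rewrite divr_ge0// ltW.
rewrite ler_pdivrMr// (le_trans _ (ler_wpM2l _ tangent))//.
  by rewrite le_eqVlt; apply/predU1P; left; field; rewrite !gt_eqF.
by rewrite !divr_ge0// ltW.
Qed.

(** * From exponential tails to integrals *)

(** A discrete layer-cake estimate: integrating the number of levels [s + k * r] below [h x] turns
    the tail bounds into a geometric series. *)
Lemma ge0_integral_le_tail d (T : measurableType d) (R : realType)
    (m : {measure set T -> \bar R}) (E : set T) (h : T -> \bar R) (s r q : R) :
  measurable E -> (m E < +oo)%E -> measurable_fun E h ->
  (forall x, E x -> 0 <= h x)%E -> 0 <= s -> 0 < r -> 0 <= q < 1 ->
  (forall k : nat,
     m (E `&` [set x | (s + k%:R * r)%:E <= h x]) <= (q ^+ k)%:E * m E)%E ->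
  (\int[m]_(x in E) h x <= (s + r / (1 - q))%:E * m E)%E.
Proof.
move=> mE Eoo mh h0 s0 r0 /andP[q0 q1] tail.
(* [(h x - s) / r] is at most the number of [k] with [x \in A k]. *)
pose A k := E `&` [set x | ((s + k%:R * r)%:E <= h x)%E].
have mA k : measurable (A k) by exact: emeasurable_fun_c_infty.
have mA1 k : measurable_fun E (fun x => (\1_(A k) x : R)%:E).
  by apply/measurable_EFinP; exact: measurable_indic.
have h_le x : E x -> (h x <= s%:E + r%:E * \sum_(k <oo) (\1_(A k) x : R)%:E)%E.
  move=> Ex; case SE : (\sum_(k <oo) (\1_(A k) x : R)%:E)%E => [y| |].
  - rewrite leNgt; apply/negP => yh.
    have y0 : 0 <= y.
      by rewrite -lee_fin -SE; apply: nneseries_ge0 => k _ _; rewrite lee_fin.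
    (* Here [x] lies in [A k] for every [k <= truncn y], so the sum would be at least
       [truncn y + 1 > y]. *)
    have /andP[_] := truncn_itv y0; apply/negP; rewrite -leNgt -lee_fin -SE.
    have -> : (((Num.truncn y).+1%:R : R)%:E =
        \sum_(0 <= k < (Num.truncn y).+1) (\1_(A k) x : R)%:E)%E.
      rewrite sumEFin big_nat (eq_bigr (fun=> 1)).
        by rewrite -big_nat big_const_nat subn0 iter_addr_0.
      move=> k /= kN; rewrite indicE mem_set//; split => //=.
      rewrite (le_trans _ (ltW yh))// -EFinM -EFinD lee_fin lerD2l mulrC.
      rewrite ler_pM2l// (@le_trans _ _ (Num.truncn y)%:R) ?truncn_le//.
      by rewrite ler_nat -ltnS.
    by apply: nneseries_lim_ge => k _ _; rewrite lee_fin.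
  - by rewrite gt0_muley ?lte_fin// addey// leey.
  - have : (0 <= \sum_(k <oo) (\1_(A k) x : R)%:E)%E.
      by apply: nneseries_ge0 => k _ _; rewrite lee_fin.
    by rewrite SE.
have mS : measurable_fun E (fun x => \sum_(k <oo) (\1_(A k) x : R)%:E)%E.
  by apply: ge0_emeasurable_sum => // k x _ _; rewrite lee_fin.
have S0 x : (0 <= \sum_(k <oo) (\1_(A k) x : R)%:E)%E.
  by apply: nneseries_ge0 => k _ _; rewrite lee_fin.
apply: (@le_trans _ _ (\int[m]_(x in E)
    (s%:E + r%:E * \sum_(k <oo) (\1_(A k) x : R)%:E))%E).
  apply: ge0_le_integral => //.
  by apply: emeasurable_funD => //; exact: measurable_funeM.
rewrite ge0_integralD//=; last 2 first.
  by move=> x _; apply: mule_ge0 => //; rewrite lee_fin ltW.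
  exact: measurable_funeM.
have rq0 : 0 <= r / (1 - q) by rewrite divr_ge0 ?ltW// subr_gt0.
rewrite integral_cst//= EFinD ge0_muleDl ?lee_fin//.
apply: leeD => //.
rewrite ge0_integralZl//; last by rewrite lee_fin ltW.
rewrite EFinM -muleA lee_pmul2l// integral_nneseries//.
under eq_eseriesr do rewrite integral_indic//.
have mE_fin : m E \is a fin_num by rewrite ge0_fin_numE.
apply: (@le_trans _ _ (\sum_(k <oo) ((q ^+ k)%:E * m E))%E).
  apply: lee_nneseries => // k _.
  by rewrite (_ : A k `&` E = A k) ?tail// /A setIAC setIid.
apply: lime_le.
  by apply: is_cvg_nneseries => k _ _; rewrite mule_ge0// lee_fin exprn_ge0.
near=> N.
rewrite -(fineK mE_fin).
under eq_bigr do rewrite -EFinM.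
rewrite sumEFin -EFinM lee_fin -mulr_suml ler_wpM2r ?fine_ge0//.
rewrite -[leRHS]div1r ler_pdivlMr ?subr_gt0// mulrC -opprB mulNr.
rewrite big_mkord -subrX1 opprB gerBl exprn_ge0//.
Unshelve. all: end_near.
Qed.

(* The ratio [N / (N + r)] replaces [expR (- r / N)], which it dominates, so that
  the case [N = 0] needs no separate treatment and [r / (1 - q) = N + r]. *)
Lemma expR_le_ratio {R : realType} (N k : nat) (r v w : R) :
  0 < r -> 0 < w <= v -> expR (k%:R * r) <= (v / w) ^+ N ->
  w <= (N%:R / (N%:R + r)) ^+ k * v.
Proof.
move=> r0 /andP[w0 wv]; case: N => [|N] H.
  (* For [N = 0] the hypothesis reads [expR (k * r) <= 1] and forces [k = 0]. *)
  case: k H => [|k]; first by rewrite expr0 mul1r.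
  by rewrite expr0 leNgt expR_gt1 mulr_gt0// ltr0n.
have v0 : 0 < v by exact: lt_le_trans wv.
set q := _ / _; have q0 : 0 < q by rewrite divr_gt0// addr_gt0// ltr0n.
have qV : q^-1 = 1 + r / N.+1%:R by rewrite /q invf_div mulrDl divff ?pnatr_eq0.
suff : q^-1 ^+ k <= v / w.
  by rewrite exprVn ler_pdivlMr// mulrC ler_pdivrMr ?exprn_gt0// mulrC.
have [qV0 vw0] : 0 <= q^-1 /\ 0 <= v / w.
  by split; rewrite ltW// ?invr_gt0// divr_gt0.
(* Compare [N.+1]-th powers, using [1 + r / N.+1 <= expR (r / N.+1)]. *)
rewrite -(@ler_pXn2r _ N.+1) ?nnegrE ?exprn_ge0//.
apply: (le_trans _ H); rewrite -exprM mulnC exprM expRM_natl.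
rewrite lerXn2r ?nnegrE ?exprn_ge0 ?expR_ge0//.
rewrite -[in leRHS](@divfK _ N.+1%:R _ r) ?pnatr_eq0// mulrC expRM_natl.
by rewrite lerXn2r ?nnegrE ?expR_ge0// qV expR_ge1Dx.
Qed.

(** * Mean oscillation of [log|f|] from a Remez-type bound *)

(** Smoothness and geometry enter only through [S], [C], [A] and the Remez-type bound. Integrability
    is a conclusion: it follows from the finite bound on the integral of [ln S - log|f|]. *)
Lemma mean_oscillation_log_abs_le {R : realType} {n : nat}
    (f : 'rV[R]_n -> R) (E : set 'rV[R]_n) (S C A : R) (N : nat) :
  lebesgue_measurable E -> (0 < lebesgue E < +oo)%E ->
  measurable_fun (E : set (euclid R n)) (log_abs f) ->
  0 < S -> 0 < C -> 0 < A -> (forall x, E x -> `|f x| <= S) ->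
  (forall F (t : R), lebesgue_measurable F -> F `<=` E -> (0 < lebesgue F)%E ->
     (forall x, F x -> `|f x| <= t) -> S <= C * (A / vol F) ^+ N * t) ->
  lebesgue.-integrable E (log_abs f) /\
  (mean_oscillation E (log_abs f) <=
     (2 * (ln C + N%:R * (1 + ln (A / vol E))))%:E)%E.
Proof.
move=> mE /[dup] E0oo /andP[E0 Eoo] mf S0 C0 A0 fS remez.
have Ev : lebesgue E = (vol E)%:E by rewrite fineK// ge0_fin_numE.
set v := vol E in Ev *.
have v0 : 0 < v by rewrite -lte_fin -Ev.
pose s := ln C + N%:R * ln (A / v).
have es : expR s = C * (A / v) ^+ N.
  by rewrite expRD lnK// expRM_natl lnK// posrE divr_gt0.
(* This is the Remez-type bound for [F = E] and [t = S]. *)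
have s0 : 0 <= s.
  rewrite -ler_expR expR0 es -(ler_pM2r S0) mul1r.
  exact: remez.
pose h x := ((ln S)%:E - log_abs f x)%E.
have fh x t : (t%:E <= h x)%E -> `|f x| <= S * expR (- t).
  rewrite /h /log_abs; have [->|fx0] := eqVneq (f x) 0.
    by rewrite normr0 mulr_ge0 ?expR_ge0// ltW.
  rewrite lne_EFin ?normr_gt0// -EFinB lee_fin => H.
  rewrite -[leLHS](@lnK _ `|f x|) ?posrE ?normr_gt0//.
  by rewrite -[S]lnK// -expRD ler_expR; lra.
have h0 x : E x -> (0 <= h x)%E.
  move=> /fS fxS; rewrite /h /log_abs; have [->|fx0] := eqVneq (f x) 0.
    by rewrite normr0 le0_lneNy// leey.
  rewrite lne_EFin ?normr_gt0// -EFinB lee_fin subr_ge0.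
  by rewrite ler_ln ?posrE ?normr_gt0.
have mh : measurable_fun (E : set (euclid R n)) h by exact: emeasurable_funB.
have intr (r : R) : 0 < r ->
    (\int[lebesgue]_(x in E) h x <= (s + (N%:R + r))%:E * lebesgue E)%E.
  move=> r0; pose q := N%:R / (N%:R + r).
  have Nr0 : 0 < N%:R + r by rewrite ltr_wpDl.
  have -> : N%:R + r = r / (1 - q).
    by rewrite /q; field; rewrite !gt_eqF//; lra.
  apply: ge0_integral_le_tail => //.
    by rewrite divr_ge0 ?(ltW Nr0)//= ltr_pdivrMr// mul1r ltrDl.
  move=> k; set F := _ `&` _.
  have mF : lebesgue_measurable F by exact: emeasurable_fun_c_infty.
  have FE : F `<=` E by move=> x [].
  (* The Remez-type bound covers sets of positive measure only; for null level sets the tail bound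
     is trivial. *)
  have [F0|] := ltP 0%E (lebesgue F); last first.
    move=> /le_trans; apply.
    by rewrite mule_ge0// lee_fin exprn_ge0// divr_ge0// ltW.
  have FEv : (lebesgue F <= lebesgue E)%E by apply: le_measure; rewrite ?inE.
  have Fv : lebesgue F = (vol F)%:E.
    by rewrite fineK// ge0_fin_numE// (le_lt_trans FEv).
  have w0 : 0 < vol F by rewrite -lte_fin -Fv.
  have wv : vol F <= v by rewrite -lee_fin -Fv -Ev.
  suff : (lebesgue F <= (q ^+ k)%:E * lebesgue E)%E by [].
  rewrite Fv Ev -EFinM lee_fin; apply: expR_le_ratio => //; first by rewrite w0.
  (* Dividing by [S] and by [expR s = C * (A / v) ^+ N] leaves
     [expR (k * r) <= (v / vol F) ^+ N]. *)
  have := remez F _ mF FE F0 (fun x Fx => fh x _ Fx.2).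
  rewrite mulrCA -[leLHS]mulr1 ler_pM2l// expRN ler_pdivlMr ?expR_gt0//.
  rewrite mul1r expRD es.
  rewrite -mulrA ler_pM2l//.
  have -> : A / vol F = A / v * (v / vol F) by field; rewrite !gt_eqF.
  by rewrite [leRHS]exprMn ler_pM2l// exprn_gt0// divr_gt0.
have inth : (\int[lebesgue]_(x in E) h x <= ((s + N%:R) * v)%:E)%E.
  (* The excess [r * v] equals [e] for [r = e / v]. *)
  apply/lee_addgt0Pr => e e0; apply: (le_trans (intr (e / v) _)).
    exact: divr_gt0.
  rewrite Ev -EFinM -EFinD lee_fin [leLHS](_ : _ = (s + N%:R) * v + e)//.
  by field; rewrite gt_eqF.
have hi : lebesgue.-integrable E h.
  apply/integrableP; split => //.
  under eq_integral => x /set_mem Ex do rewrite gee0_abs ?h0//.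
  by rewrite (le_lt_trans inth) ?ltry.
have fi : lebesgue.-integrable E (log_abs f).
  have ci : lebesgue.-integrable E (cst (ln S)%:E).
    apply/integrableP; split; first exact: measurable_cst.
    by rewrite integral_cst//= Ev -EFinM ltry.
  have := integrableB mE ci hi; apply: eq_integrable => // x _ /=.
  by rewrite /h oppeB ?fin_num_adde_defr// addeA subee// add0e.
split=> //; apply: (le_trans (mean_oscillation_le E _ (ln S) mE E0oo fi)).
under eq_integral => x /set_mem Ex do rewrite gee0_abs ?h0//.
rewrite EFinM lee_pmul2l// -/v.
rewrite (_ : (_ + _)%:E = (v^-1%:E * ((s + N%:R) * v)%:E)%E); last first.
  by rewrite -EFinM; congr EFin; rewrite /s; field; rewrite gt_eqF.
by rewrite lee_pmul2l// lte_fin invr_gt0.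
Qed.

Theorem corollary7p6 (R : realType) (n : nat) (hn : (1 <= n)%N)
  (mut : (nat -> R) -> R -> R)
  (hmut : forall mu, admissible_weight mu -> interpolant mu (mut mu))
  (L K : set 'rV[R]_n) (hL : convex_body L)
  (d : nat) (hK : admissible_set d K) (hd : convex_body K -> d = 1%N)
  (nuK : R) (hnuK : remez_exponent mut d K nuK)
  (hKL : K `<=` L)
  (mu : nat -> R) (hmu : admissible_weight mu)
  (hmuj : forall j, (1 <= j)%N -> j%:R <= mu j)
  (M0 b0 : R) (hb0 : 0 < b0) (hM0 : b0 < M0)
  (hadm : admissible_tuple mu M0 (constA d K) b0)
  (f : 'rV[R]_n -> R)
  (hf : smooth mu (degree mu M0 (constA d K) b0) M0 L (fun _ : 'I_1 => f))
  (hfK : b0 <= sup_norm K (fun _ : 'I_1 => f))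
  (E : set 'rV[R]_n) (mE : lebesgue_measurable E) (hEK : E `<=` K)
  (hE : (0 < lebesgue E)%E) :
  let N := degree mu M0 (constA d K) b0 in
  lebesgue.-integrable E (log_abs f) /\
  (mean_oscillation E (log_abs f) <=
     (2 * ln (constC (mut mu) N)
      + 2 * N%:R * (1 + ln (vol K / (nuK * vol E))))%:E)%E.
Proof.
move=> N; set A := vol K; set C := constC (mut mu) N.
have [nu01 _ remez] := hnuK; have /andP[nu0 _] := nu01.
have [[U [oU LU /(_ ord0)[_ cfU]]] _] := hf.
have [_ cK _] := hK.
pose f1 : 'I_1 -> 'rV[R]_n -> R := fun=> f.
set S := sup_norm K f1.
have S0 : 0 < S by exact: lt_le_trans hfK.
have f1E x : \sum_(i < 1) `|f1 i x| = `|f x| by rewrite big_ord1.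
have fS x : K x -> `|f x| <= S.
  move=> Kx; rewrite -f1E; apply: ub_le_sup; last by exists x.
  pose values := [set \sum_(i < 1) `|f1 i x| | x in K].
  have [[]//|/sup_out S_eq0] := pselect (has_sup values).
  (* [sup] is 0 on unbounded sets. *)
  by move: S0; rewrite /S /sup_norm S_eq0 ltxx.
have Koo := compact_lebesgue_lty K cK.
have le_vol (F G : set 'rV[R]_n) :
    lebesgue_measurable F -> F `<=` G -> G `<=` K ->
    (0 < lebesgue F)%E -> 0 < vol F <= vol G.
  move=> mF FG GK F0.
  have FGl : (lebesgue F <= lebesgue G)%E by exact: le_outer_measure.
  have Goo : (lebesgue G < +oo)%E.
    by apply: le_lt_trans Koo; exact: le_outer_measure.
  rewrite -!lte_fin -lee_fin /vol !fineK ?ge0_fin_numE ?F0 ?FGl//.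
  exact: le_lt_trans Goo.
have C0 : 0 < C by rewrite exprn_gt0// mulr_gt0// expR_gt0.
have /andP[v0 vA] := le_vol E K mE hEK (fun x Kx => Kx) hE.
have A0 : 0 < A by exact: lt_le_trans vA.
have Eoo : (lebesgue E < +oo)%E.
  by apply: le_lt_trans Koo; exact: le_outer_measure.
have mf : measurable_fun (E : set (euclid R n)) (log_abs f).
  apply: (measurable_log_abs _ U) => //; first by move=> x /hEK /hKL /LU.
  by move=> x Ux; exact: (cfU [::]).
have [fi mo] : lebesgue.-integrable E (log_abs f) /\
    (mean_oscillation E (log_abs f) <=
     (2 * (ln C + N%:R * (1 + ln (A / nuK / vol E))))%:E)%E.
  (* The role of [A] in the lemma is played by [A / nuK], which is [|K| / nuK]. *)
  apply: (mean_oscillation_log_abs_le f E S) => //; first by rewrite hE.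
  - by rewrite divr_gt0.
  - by move=> x /hEK; exact: fS.
  move=> F t mF FE F0 ft.
  have FK : F `<=` K by exact: subset_trans hEK.
  have /andP[w0 wA] := le_vol F K mF FK (fun x Kx => Kx) F0.
  have := remez L mu M0 b0 1%N hL hKL hmu hmuj hb0 hM0 isT.
  rewrite !mul1r => /(_ hadm f1 hf hfK F mF FK F0); rewrite -/A -/N -/C -/S.
  move=> /le_trans; apply.
  (* A point of [F] gives [0 <= t], and lets the supremum over [F] be bounded by [t]. *)
  have F_neq0 : F !=set0.
    by apply/set0P; apply: contraTneq F0 => ->; rewrite measure0 ltxx.
  have t0 : 0 <= t by have [x /ft] := F_neq0; exact: le_trans.
  have := powR_ratio_le A (vol F) nuK nu01.
  rewrite w0 wA => /(_ isT)/andP[q0 qB].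
  apply: (@le_trans _ _ (C * (A `^ nuK / (A `^ nuK - (A - vol F) `^ nuK)) ^+ N * t)).
    rewrite ler_wpM2l ?mulr_ge0 ?exprn_ge0 ?(ltW C0)//.
    apply: ge_sup; first by case: F_neq0 => x Fx; exists `|f x|, x.
    by move=> _ [x Fx <-]; rewrite f1E; exact: ft.
  rewrite ler_wpM2r// ler_pM2l// lerXn2r ?nnegrE//.
  exact: le_trans qB.
split=> //; apply: (le_trans mo); rewrite lee_fin -/A.
rewrite (_ : A / nuK / vol E = A / (nuK * vol E)); last by field; rewrite !gt_eqF.
lra.
Qed.
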